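(* Let $\mathcal{R}\subset\mathbb{R}_+^K$ be a compact, convex and coordinate-convex rate region, and let $\{\mathbf{A}^L\}_{L\in\mathbb{N}}$ be a sequence of arrival processes such that: (i) $\{\mathbf{A}^L\}$ satisfies a sample path LDP in $\mathcal{D}^K_{\boldsymbol{\mu}}$, equipped with the scaled uniform topology, with rate function $I^\sharp$; for every $t\in\mathbb{N}$, $\{\mathbf{A}^L|_{(0,t]}\}$ satisfies an LDP in $\mathbb{R}_+^{K\times t}$ (product topology) with rate function $I^\sharp_t$; and $I^\sharp(\mathbf{a})=\sup_{t\in\mathbb{N}}I^\sharp_t(\mathbf{a}|_{(0,t]})=\lim_{t\to\infty}I^\sharp_t(\mathbf{a}|_{(0,t]})$ for $\mathbf{a}\in\mathcal{D}^K_{\boldsymbol{\mu}}$; (ii) for every $t\in\mathbb{N}$, $I^\sharp_t$ is continuous on $\mathbb{R}_+^{K\times t}$ in the product topology. Then for every $t\in\mathbb{N}$, the sequence of finite-horizon workloads under the max-weight scheduler, $\{\mathbf{W}^L_{0,t}:=G_t(\mathbf{A}^L|_{(0,t]})\}_{L}$, satisfies an LDP on $\mathbb{R}_+^K$ with rate function $I_t$ given for $\mathbf{b}\in\mathbb{R}_+^K$ by $$I_t(\mathbf{b})=\inf\{I^\sharp_t(\mathbf{x}):\ \mathbf{x}\in\mathbb{R}_+^{K\times t},\ \mathbf{b}\in{}^{\mathbf{x}}G_t\}.$$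
   Context: Conventions: $\mathbb{N}=\{1,2,\dots\}$, $K\in\mathbb{N}$, $[\mathbf{x}]^+=\max\{\mathbf{0},\mathbf{x}\}$ coordinatewise; vector inequalities are coordinatewise. A set $\mathcal{R}\subset\mathbb{R}_+^K$ is coordinate-convex if $\boldsymbol{\mu}_1\in\mathcal{R}$, $\boldsymbol{\mu}_2\in\mathbb{R}_+^K$, $\boldsymbol{\mu}_2\le\boldsymbol{\mu}_1$ imply $\boldsymbol{\mu}_2\in\mathcal{R}$. Quasi-continuity: a function $F:\mathcal{X}\to\mathcal{Y}$ between complete metric spaces is quasi-continuous if for each $x\in\mathcal{X}$ there is a sequence $x_n\to x$ with $F(x_n)\to F(x)$ such that $F$ is continuous at every $x_n$. Cluster set: for $F:\mathcal{X}\to\mathcal{Y}$ and $x\in\mathcal{X}$, ${}^{x}F:=\{y\in\mathcal{Y}:\exists\,x_n\to x\text{ with }F(x_n)\to y\}$. Scheduler and workload: $H:\mathbb{R}_+^K\to\mathcal{R}$ is a fixed quasi-continuous function with $H(\mathbf{w})\in\arg\max_{\mathbf{R}\in\mathcal{R}}\langle\mathbf{R},\mathbf{w}\rangle$ for all $\mathbf{w}$ (the max-weight scheduling function). For arrivals $(\mathbf{a}_s)_{s\in\mathbb{N}}$, $\mathbf{a}_s\in\mathbb{R}_+^K$ being the work arriving at time $-s$, the workload at time $-s$, started from $\mathbf{W}_T=\mathbf{0}$ at time $-T$, evolves by $\mathbf{W}_{s-1}=[\mathbf{W}_s-H(\mathbf{W}_s)]^++\mathbf{a}_s$, $s=T,\dots,1$.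 With $\mathbf{a}|_{(m_1,m_2]}$ denoting $(\mathbf{a}_{m_1+1},\dots,\mathbf{a}_{m_2})$, $G_T:\mathbb{R}_+^{K\times T}\to\mathbb{R}_+^K$ maps $\mathbf{a}|_{(0,T]}$ to the workload $\mathbf{W}_0$ at time $0$, denoted $\mathbf{W}_{0,T}$. Sample-path space: for $x:\mathbb{N}\to\mathbb{R}_+$ put $x(0,t]=\sum_{s=1}^t x_s$. $\mathcal{D}$ is the set of such $x$ with $\|x\|_u:=\sup_{t\in\mathbb{N}}|x(0,t]/t|<\infty$, with metric $\|x-y\|_u=\sup_t|(x(0,t]-y(0,t])/t|$ (the scaled uniform topology). $\mathcal{D}_\mu:=\{x\in\mathcal{D}:\lim_{t\to\infty}x(0,t]/t=\mu\}$. For $\boldsymbol{\mu}=(\mu^1,\dots,\mu^K)\in\mathbb{R}_+^K$, $\mathcal{D}^K_{\boldsymbol{\mu}}:=\prod_k\mathcal{D}_{\mu^k}$, with the product topology (norm $\max_k\|a^k\|_u$). Arrivals: for each $L$, $\mathbf{A}^L=(A^{k,L},k=1,\dots,K)$ with $A^{k,L}=(A^{k,L}_t,t\in\mathbb{N})$ a stationary $\mathbb{R}_+$-valued random sequence; arrivals to different queues are mutually independent; $\boldsymbol{\mu}$ is the vector of expected arrival rates. LDP: random elements $X^L$ of a Hausdorff space $\mathcal{X}$ with $\sigma$-algebra $\mathcal{B}$ (Borel) satisfy an LDP with (good) rate function $I:\mathcal{X}\to\mathbb{R}_+\cup\{\infty\}$ if all level sets $\{x:I(x)\le\alpha\}$,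 $\alpha\in\mathbb{R}$, are compact and, for every $B\in\mathcal{B}$ with interior $B^o$ and closure $\bar B$, $-\inf_{x\in B^o}I(x)\le\liminf_{L\to\infty}\frac1L\log P(X^L\in B)\le\limsup_{L\to\infty}\frac1L\log P(X^L\in B)\le-\inf_{x\in\bar B}I(x)$. A sample path LDP is an LDP for random sequences.
   Formalization: The max-weight scheduling function H is additionally assumed to be Borel measurable; otherwise non-Borel tie-breaking can make the workloads non-measurable, so that their LDP is undefined. *)

(* Defs.v *)
From HB Require Import structures.
From mathcomp Require Import all_boot all_order all_algebra.
From mathcomp Require Import all_classical all_reals all_analysis.

Set Implicit Arguments.
Unset Strict Implicit.
Unset Printing Implicit Defensive.

Import Order.TTheory GRing.Theory Num.Theory.
Import numFieldNormedType.Exports.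

Local Open Scope classical_set_scope.
Local Open Scope ring_scope.

(* The set N = {1, 2, ...} of time slots and of
   scaling parameters is encoded by nat with a shift: index [s : nat] of a
   sequence of arrivals is time slot [s.+1], and index [L : nat] of a family
   of random elements is scaling parameter [L.+1]. Horizons [t] are not shifted
   and are restricted by [(0 < t)%N]. *)

Section Topology.

Definition borel (X : topologicalType) : set (set X) := <<s @open X >>.

Definition borel_fun (X Y : topologicalType) (F : X -> Y) :=
  forall B, borel B -> borel (F @^-1` B).

Definition quasi_continuous (X Y : topologicalType) (F : X -> Y) :=
  forall x, exists u : nat -> X,
    [/\ u @ \oo --> x, (F \o u) @ \oo --> F x &
        forall n, {for u n, continuous F}].

Definition cluster_set (X Y : topologicalType) (F : X -> Y) (x : X) : set Y :=
  [set y | exists u : nat -> X, u @ \oo --> x /\ (F \o u) @ \oo --> y].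

End Topology.

Section Probability.
Context {R : realType}.

Definition random_element d (Omega : measurableType d) (X : topologicalType)
    (Z : Omega -> X) :=
  forall B, borel B -> measurable (Z @^-1` B).

Definition rate_function (X : topologicalType) (I : X -> \bar R) :=
  (forall x, 0 <= I x)%E /\
  forall alpha : R, compact [set x | (I x <= alpha%:E)%E].

(* [lne 0 = -oo], so null events need no special treatment. *)
Definition LDP (d : nat -> measure_display)
    (Omega : forall L, measurableType (d L))
    (P : forall L, probability (Omega L) R) (X : topologicalType)
    (Z : forall L, Omega L -> X) (I : X -> \bar R) :=
  [/\ forall L, random_element (Z L), rate_function I &
    forall B : set X, borel B ->
      let p := fun L => ((L.+1%:R^-1)%:E * lne (P L (Z L @^-1` B)))%E in
      (- ereal_inf [set I x | x in interior B] <= limn_einf p)%E /\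
      (limn_esup p <= - ereal_inf [set I x | x in closure B])%E].

Definition stationary d (Omega : measurableType d) (P : probability Omega R)
    (Z : Omega -> nat -> R) :=
  forall (h n : nat) (B : set 'rV[R]_n), borel B ->
    P [set w | B (\row_(i < n) Z w (h + i)%N)] =
    P [set w | B (\row_(i < n) Z w i)].

Definition sigma_of d (Omega : measurableType d) (Z : Omega -> nat -> R) :
    set (set Omega) :=
  <<s [set E | exists s (B : set R), borel B /\ E = [set w | B (Z w s)]] >>.

Definition mutually_independent d (Omega : measurableType d)
    (P : probability Omega R) (K : nat) (Z : 'I_K -> Omega -> nat -> R) :=
  forall (J : {set 'I_K}) (E : 'I_K -> set Omega),
    (forall k, k \in J -> sigma_of (Z k) (E k)) ->
    P (\bigcap_(k in [set` J]) E k) = (\prod_(k in J) P (E k))%E.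

End Probability.

Section PathSpace.
Variable R : realType.

Definition average (x : nat -> R) (t : nat) : R := (\sum_(s < t) x s) / t%:R.

Definition scaled_norm (x : nat -> R) : \bar R :=
  ereal_sup [set (`|average x t|)%:E | t in [set t | (0 < t)%N]].

Record path_space := PathSpace {
  path_val :> nat -> R ;
  path_ge0 : forall s, 0 <= path_val s ;
  path_bounded : (scaled_norm path_val < +oo)%E }.

Definition path_dist (x y : path_space) : R :=
  fine (scaled_norm (fun s => x s - y s)).

Lemma averageB (x y : nat -> R) t :
  average (fun s => x s - y s) t = average x t - average y t.
Proof. by rewrite /average sumrB mulrBl. Qed.

Lemma scaled_norm_ubound (x : nat -> R) t :
  (0 < t)%N -> ((`|average x t|)%:E <= scaled_norm x)%E.
Proof. by move=> t0; apply: ereal_sup_ubound; exists t. Qed.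

Lemma scaled_norm_ge0 (x : nat -> R) : (0 <= scaled_norm x)%E.
Proof.
by apply: (le_trans _ (scaled_norm_ubound x (ltn0Sn 0))); rewrite lee_fin.
Qed.

Lemma scaled_norm_le (x : nat -> R) (y : \bar R) :
  (forall t, (0 < t)%N -> ((`|average x t|)%:E <= y)%E) ->
  (scaled_norm x <= y)%E.
Proof. by move=> xy; apply: ge_ereal_sup => _ [t t0 <-]; exact: xy. Qed.

Lemma path_dist_fin (x y : path_space) :
  scaled_norm (fun s => x s - y s) \is a fin_num.
Proof.
rewrite ge0_fin_numE ?scaled_norm_ge0//.
apply: (@le_lt_trans _ _ (scaled_norm x + scaled_norm y)%E); last first.
  by rewrite lte_add_pinfty// path_bounded.
apply: scaled_norm_le => t t0; rewrite averageB.
apply: (@le_trans _ _ ((`|average x t|)%:E + (`|average y t|)%:E)%E).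
  by rewrite -EFinD lee_fin ler_normB.
by rewrite leeD// scaled_norm_ubound.
Qed.

Lemma path_dist_ge (x y : path_space) t :
  (0 < t)%N -> `|average x t - average y t| <= path_dist x y.
Proof.
move=> t0; rewrite -lee_fin /path_dist fineK ?path_dist_fin// -averageB.
exact: scaled_norm_ubound.
Qed.

Lemma path_dist_le (x y : path_space) (e : R) :
  (forall t, (0 < t)%N -> `|average x t - average y t| <= e) ->
  path_dist x y <= e.
Proof.
move=> xye; rewrite -lee_fin /path_dist fineK ?path_dist_fin//.
by apply: scaled_norm_le => t t0; rewrite lee_fin averageB xye.
Qed.

Lemma path_distxx (x : path_space) : path_dist x x = 0.
Proof.
apply/eqP; rewrite eq_le; apply/andP; split.
  by apply: path_dist_le => t _; rewrite subrr normr0.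
by apply: le_trans (path_dist_ge x x (ltn0Sn 0)).
Qed.

Lemma path_dist_positivity (x y : path_space) : path_dist x y = 0 -> x = y.
Proof.
move=> xy0.
have sumE t : \sum_(s < t) x s = \sum_(s < t) y s.
  case: t => [|t]; first by rewrite !big_ord0.
  have := path_dist_ge x y (ltn0Sn t).
  rewrite xy0 normr_le0 subr_eq0 /average => /eqP.
  by apply: mulIf; rewrite invr_eq0 pnatr_eq0.
have xyE : path_val x = path_val y.
  apply/funext => s; have := sumE s.+1.
  by rewrite !big_ord_recr/= sumE => /addrI.
case: x y xyE {xy0 sumE} => [x x0 xb] [y y0 yb] /= xyE; subst y.
by congr PathSpace; exact: Prop_irrelevance.
Qed.

Lemma path_dist_sym (x y : path_space) : path_dist x y = path_dist y x.
Proof.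
by apply/eqP; rewrite eq_le; apply/andP; split;
  apply: path_dist_le => t t0; rewrite distrC path_dist_ge.
Qed.

Lemma path_dist_triangle (y x z : path_space) :
  path_dist x z <= path_dist x y + path_dist y z.
Proof.
apply: path_dist_le => t t0.
by rewrite (le_trans (ler_distD (average y t) _ _))// lerD// path_dist_ge.
Qed.

HB.instance Definition _ := gen_eqMixin path_space.
HB.instance Definition _ := gen_choiceMixin path_space.
HB.instance Definition _ := isMetric.Build R path_space
  path_distxx path_dist_positivity path_dist_sym path_dist_triangle.

Definition mean_paths (m : R) : set path_space :=
  [set x : path_space | average x t @[t --> \oo] --> m].

End PathSpace.

(* [orthant R m n] as a type carries the subspace topology of the matrices;
   R_+^K is [orthant R K 1] and R_+^(K x t) is [orthant R K t], with column [s]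
   holding the arrivals of time slot [s.+1]. *)
Definition orthant (R : realType) (m n : nat) : set 'M[R]_(m, n) :=
  [set M | forall i j, 0 <= M i j].
Arguments orthant R m n : clear implicits.

Section MaxWeight.
Variables (R : realType) (K : nat).

Lemma orthantP m n (M : orthant R m n) i j : 0 <= val M i j.
Proof. by have := set_mem (valP M); exact. Qed.

Definition to_orthant m n (M : 'M[R]_(m, n)) (M0 : orthant R m n M) :
    orthant R m n :=
  exist _ M (mem_set M0).

Definition path_spaceK (mu : orthant R K 1) : topologicalType :=
  prod_topology (fun k : 'I_K => mean_paths (val mu k 0)).

Lemma restrict_path_subproof (mu : orthant R K 1) t (a : path_spaceK mu) :
  orthant R K t (\matrix_(k < K, s < t) val (a k) s).
Proof. by move=> k s; rewrite mxE path_ge0. Qed.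

Definition restrict_path (mu : orthant R K 1) t (a : path_spaceK mu) :
    orthant R K t :=
  to_orthant (restrict_path_subproof (t := t) a).

Definition coordinate_convex (Rg : set 'cV[R]_K) :=
  forall r1 r2 : 'cV[R]_K, Rg r1 -> orthant R K 1 r2 ->
    (forall k, r2 k 0 <= r1 k 0) -> Rg r2.

Definition inner (u v : 'cV[R]_K) : R := \sum_(k < K) u k 0 * v k 0.

Definition weight_argmax (Rg : set 'cV[R]_K) (w : 'cV[R]_K) : set 'cV[R]_K :=
  [set r | Rg r /\ forall r', Rg r' -> inner r' w <= inner r w].

Section Workload.
Variables (Rg : set 'cV[R]_K) (H : orthant R K 1 -> Rg).

Lemma step_subproof (w : orthant R K 1) T (a : orthant R K T) s :
  orthant R K 1 (\col_(k < K)
    (Num.max 0 (val w k 0 - val (H w) k 0) + val a k s)).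
Proof.
by move=> k j; rewrite mxE addr_ge0 ?orthantP// le_max lexx.
Qed.

Definition step T (a : orthant R K T) (s : 'I_T) (w : orthant R K 1) :
    orthant R K 1 :=
  to_orthant (step_subproof w a s).

Lemma zero_subproof : orthant R K 1 (0 : 'cV[R]_K).
Proof. by move=> k j; rewrite mxE. Qed.

(* [enum 'I_T] is increasing, so the slots are processed from the oldest one,
   [T], down to slot 1. *)
Definition workload T (a : orthant R K T) : orthant R K 1 :=
  foldr (step a) (to_orthant zero_subproof) (enum 'I_T).

End Workload.

End MaxWeight.

(* Main.v *)
Require Import Defs.
From mathcomp Require Import all_boot all_order all_algebra.
From mathcomp Require Import all_classical all_reals all_analysis.
From mathcomp Require Import ring lra.

Set Implicit Arguments.
Unset Strict Implicit.
Unset Printing Implicit Defensive.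

Import Order.TTheory GRing.Theory Num.Theory.
Import numFieldNormedType.Exports.

Local Open Scope classical_set_scope.
Local Open Scope ring_scope.

(** The law for the workloads is an extended contraction principle: the arrivals
    up to a finite horizon satisfy an LDP with a continuous rate function, and
    the workload is a function of them which, although discontinuous, is
    quasi-continuous and locally bounded.

    Why this is enough ([LDP_quasi_continuous]).  Let F be such a function and
    write xF for its cluster set at x, that is, for the fibre over x of the
    closure of the graph of F.
    - Upper bound: F(x) in B forces xF to meet the closure of B.  Since F is
      locally bounded, the set D of all x with this property is closed
      ([closed_cluster_meets]), and the infimum of I over D dominates the infimum
      of the claimed rate function over the closure of B.
    - Lower bound: if xF meets the interior of B, then quasi-continuity puts
      continuity points of F with values in the interior of B arbitrarily close to
      x.  So x is a limit of interior points of the preimage of B, and the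
      continuity of I transfers the lower bound from these points to x.
    - Goodness: the sublevel sets are intersections of images of sublevel sets of
      I under the relation x |-> xF, and these images are compact
      ([compact_cluster_image]).

    Why the workload is quasi-continuous ([quasi_continuous_workload]).  One slot
    maps W to drain W + a with drain W = [W - H W]^+, so the finite-horizon
    workload is a composition, and quasi-continuity does not survive composition
    in general.  It is enough to perturb the arrivals so that every intermediate
    workload becomes a continuity point of H.  Going backwards in time, suppose
    that the workload after a slot has been moved to a point x with positive
    coordinates.  The workload before that slot has to be moved to a nearby
    continuity point w' whose H-value is also close, and the new arrival
    x - drain w' has to be nonnegative, that is, drain w' <= x.  This is where the
    max-weight rule enters: at an interior continuity point u of H the maximizer
    is unique ([argmax_unique]), and maximizers do not change along rays, so
    H (c u) = H u for every c > 0.  Taking c slightly below 1 lowers the workload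
    by a definite amount without changing the service, which absorbs the errors in
    all coordinates where the workload is positive; in the other coordinates the
    workload before the slot is moved by less than the coordinate of x
    ([drain_below]).  An induction on the horizon ([workload_steering]) assembles
    the perturbations. *)

(** * Cluster sets and quasi-continuity *)

Section UltraMap.
Context {X : topologicalType} {T : Type}.

Lemma ultra_compact_cvg (G : set_system T) (f : T -> X) (Q : set X) :
  UltraFilter G -> compact Q -> G (f @^-1` Q) ->
  exists2 x, Q x & f @ G --> x.
Proof.
move=> GU Qc GQ; have [x [Qx xG]] := Qc (f @ G) _ GQ.
exists x => // N xN; have [//|GN] := in_ultra_setVsetC (f @^-1` N) GU.
by have [z []] := xG (~` N) N GN xN.
Qed.

End UltraMap.

Section Cluster.
Context {R : realType} {X Y : pseudoMetricType R}.
Implicit Type F : X -> Y.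

Let small_ball (n : nat) : 0 < n.+1%:R^-1 :> R.
Proof. by rewrite invr_gt0. Qed.

Let cvg_of_balls (T : pseudoMetricType R) (u : nat -> T) (l : T) :
  (forall n, ball l n.+1%:R^-1 (u n)) -> u @ \oo --> l.
Proof.
move=> lu; apply/cvg_ballP => e e0.
near=> n; apply: (@le_ball _ _ l n.+1%:R^-1 e) => //.
by near: n; apply: filterS (near_infty_natSinv_lt (PosNum e0)) => n /ltW.
Unshelve. all: by end_near. Qed.

(** Countable neighbourhood bases let the sequences in the definition be traded
    for filters, which makes the compactness arguments below sequence-free. *)
Lemma cluster_setE F x : cluster_set F x = cluster (F @ x).
Proof.
apply/seteqP; split => [y [u [ux uy]] A B /= xA yB|y yP].
  have uA : \forall n \near \oo, A (F (u n)) by exact: (ux (F @^-1` A) xA).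
  have uB : \forall n \near \oo, B (F (u n)) by exact: (uy B yB).
  have [n [An Bn]] := filter_ex (filterI uA uB).
  by exists (F (u n)).
have /choice[u uP] n : exists z,
    ball x n.+1%:R^-1 z /\ ball y n.+1%:R^-1 (F z).
  have xn : (F @ x) (F @` ball x n.+1%:R^-1).
    by apply: filterS (nbhsx_ballx x _ (small_ball n)) => z xz; exists z.
  have [_ [[z xz <-] yz]] := yP _ _ xn (nbhsx_ballx y _ (small_ball n)).
  by exists z.
by exists u; split; apply: cvg_of_balls => n; have [] := uP n.
Qed.

Lemma quasi_continuousP F : quasi_continuous F <->
  forall x U V, nbhs x U -> nbhs (F x) V ->
    exists v, [/\ U v, V (F v) & {for v, continuous F}].
Proof.
split=> [qF x U V xU xV|qF x].
  have [u [ux uF uc]] := qF x.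
  have uU : \forall n \near \oo, U (u n) by exact: (ux U xU).
  have uV : \forall n \near \oo, V (F (u n)) by exact: (uF V xV).
  have [n [Un Vn]] := filter_ex (filterI uU uV).
  by exists (u n).
have /choice[u uP] n := qF x _ _ (nbhsx_ballx x _ (small_ball n))
  (nbhsx_ballx (F x) _ (small_ball n)).
exists u; split; first by apply: cvg_of_balls => n; have [] := uP n.
  by apply: cvg_of_balls => n; have [] := uP n.
by move=> n; have [] := uP n.
Qed.

End Cluster.

Definition locally_relatively_compact (X Y : topologicalType) (F : X -> Y) :=
  forall x : X, exists2 C, compact C & \forall z \near x, C (F z).

Section ClusterCompact.
Context {X Y : topologicalType} (F : X -> Y).
Hypothesis Y_hausdorff : hausdorff_space Y.
Hypothesis F_compact : locally_relatively_compact F.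

Let cluster_near (x : X) : exists2 C, compact C &
  \forall z \near x, cluster (F @ z) `<=` C.
Proof.
have [C Cc xC] := F_compact x; exists C => //.
near=> z => y zy.
have zC : nbhs z (F @^-1` C) by near: z; exact: nbhs_interior.
have /closure_id-> := compact_closed Y_hausdorff Cc.
by move=> V yV; exact: zy.
Unshelve. all: by end_near. Qed.

(* The graph of [x |-> cluster (F @ x)] is closed. *)
Let cluster_closed (x : X) (A V : set Y) (b : Y) : (F @ x) A -> nbhs b V ->
  (forall (U : set X) W, nbhs x U -> nbhs b W ->
    exists z c, [/\ U z, W c & cluster (F @ z) c]) -> A `&` V !=set0.
Proof.
move=> xA bV zc.
have [z [c [zA cV]]] := zc _ _ (nbhs_interior xA) (nbhs_interior bV).
by apply.
Qed.

(** Let x be adherent to this set, and choose for each nearby point z of it a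
    cluster value of F at z that lies in B.  These values stay in a compact set, so
    they accumulate somewhere in B as z tends to x, and the limit is a cluster
    value of F at x. *)
Lemma closed_cluster_meets (B : set Y) : closed B ->
  closed [set x | cluster (F @ x) `&` B !=set0].
Proof.
move=> Bcl x xD; set D := [set _ | _] in xD *.
have /choice[f fP] z : exists y, D z -> cluster (F @ z) y /\ B y.
  by have [[y]|nD] := pselect (D z); [exists y|exists (F z)].
have [C Cc xC] := cluster_near x.
have GF : ProperFilter (within D (nbhs x)) by exact: within_nbhs_proper.
have GC : (f @ within D (nbhs x)) C.
  by apply: filterS xC => z zC /fP[/zC].
have [b [Cb bG]] := Cc (f @ within D (nbhs x)) _ GC.
exists b; split.
  move=> A V xA bV; apply: (cluster_closed xA bV) => U W xU bW.
  have GU : (f @ within D (nbhs x)) (f @` (U `&` D)).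
    by apply: filterS xU => z Uz Dz; exists z.
  have [_ [[z [Uz Dz] <-] Wz]] := bG _ _ GU bW.
  by exists z, (f z); split => //; have [] := fP _ Dz.
apply: Bcl => V bV; apply: bG => //.
by apply: nearW => z /fP[].
Qed.

(** An ultrafilter on the image is followed back to Q, where it converges to some
    x; near x all cluster values lie in one compact set, so the ultrafilter itself
    converges, necessarily to a cluster value at x. *)
Lemma compact_cluster_image (Q : set X) : compact Q ->
  compact [set y | exists2 x, Q x & cluster (F @ x) y].
Proof.
move=> Qc; rewrite compact_ultra => G GU GS; set S := [set _ | _] in GS *.
have [y0 [x0 _ _]] := filter_ex GS.
have /choice[f fP] y : exists x, S y -> Q x /\ cluster (F @ x) y.
  by have [[x]|nS] := pselect (S y); [exists x|exists x0].
have GQ : G (f @^-1` Q) by apply: filterS GS => y /fP[].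
have [x Qx cvfx] := ultra_compact_cvg GU Qc GQ.
have fx N : nbhs x N -> G (f @^-1` N) by exact: cvfx.
have [C Cc xC] := cluster_near x.
have GC : G C by apply: filterS (filterI GS (fx _ xC)) => y [/fP[_ ?]]; exact.
move: Cc; rewrite compact_ultra => /(_ G GU GC)[b [Cb Gb]].
exists b; split=> //; exists x => // A V xA bV.
apply: (cluster_closed xA bV) => U W xU bW.
have [y [[Sy Uy] Wy]] := filter_ex (filterI (filterI GS (fx _ xU)) (Gb _ bW)).
by exists (f y), y; split => //; have [] := fP _ Sy.
Qed.

End ClusterCompact.

(** * The contraction principle *)

Section Limn.
Context {R : realType}.
Implicit Types u v : nat -> \bar R.
Local Open Scope ereal_scope.

Lemma le_limn_esup u v : (forall n, u n <= v n) -> limn_esup u <= limn_esup v.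
Proof.
move=> uv; rewrite !limn_esup_lim; apply: lee_lim.
- exact: is_cvg_esups.
- exact: is_cvg_esups.
apply: nearW => n; apply: ge_ereal_sup => _ [k /= nk <-].
by apply: (le_trans (uv k)); apply: ereal_sup_ubound; exists k.
Qed.

Lemma le_limn_einf u v : (forall n, u n <= v n) -> limn_einf u <= limn_einf v.
Proof. by move=> uv; rewrite leeN2 le_limn_esup// => n; rewrite leeN2. Qed.

End Limn.

Section Contraction.
Context {R : realType} (d : nat -> measure_display)
  (Omega : forall L, measurableType (d L)) (P : forall L, probability (Omega L) R)
  (X Y : pseudoMetricType R).
Local Open Scope ereal_scope.

Let log_prob (T : topologicalType) (Z : forall L, Omega L -> T) (B : set T) L :=
  (L.+1%:R^-1)%:E * lne (P L (Z L @^-1` B)).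

Let le_log_prob (T T' : topologicalType) (Z : forall L, Omega L -> T)
    (Z' : forall L, Omega L -> T') B B' :
    (forall L, random_element (Z L)) -> (forall L, random_element (Z' L)) ->
    borel B -> borel B' ->
    (forall L, Z L @^-1` B `<=` Z' L @^-1` B') ->
  forall L, log_prob Z B L <= log_prob Z' B' L.
Proof.
move=> mZ mZ' bB bB' BB' L; rewrite lee_pmul2l ?lte_fin ?invr_gt0//.
rewrite lee_lne ?in_itv/= ?measure_ge0 ?leey//.
by apply: le_measure; rewrite ?inE; [exact: mZ|exact: mZ'|exact: BB'].
Qed.

Let borel_open (T : topologicalType) (B : set T) : open B -> borel B.
Proof. exact: sub_gen_smallest. Qed.

Let borel_closed (T : topologicalType) (B : set T) : closed B -> borel B.
Proof.
move=> Bcl; rewrite -(setCK B) -setTD.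
by apply: sigma_algebraCD; apply: borel_open; exact: closed_openC.
Qed.

(** Continuity of the rate function is what makes quasi-continuity sufficient: the
    lower bound is only available on the interior of the preimage, and the points
    of interest are merely adherent to that interior. *)
Lemma LDP_quasi_continuous (Z : forall L, Omega L -> X) (I : X -> \bar R)
    (F : X -> Y) :
    hausdorff_space Y -> continuous I -> LDP P Z I ->
    quasi_continuous F -> locally_relatively_compact F ->
    (forall L, random_element (F \o Z L)) ->
  LDP P (fun L => F \o Z L)
    (fun y => ereal_inf [set I x | x in [set x | cluster_set F x y]]).
Proof.
move=> hY cI [mZ [I0 Icpt] ldp] /quasi_continuousP qF cF mFZ.
pose J y := ereal_inf [set I x | x in [set x | cluster (F @ x) y]].
have -> : (fun y => ereal_inf [set I x | x in [set x | cluster_set F x y]]) = J.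
  apply/funext => y; congr (ereal_inf (I @` _)).
  by apply/funext => x; rewrite /mkset cluster_setE.
split => //.
- split=> [y|a].
    by apply: le_ereal_inf_tmp => _ [x _ <-]; exact: I0.
  (* Intersecting over [e > 0] avoids showing that the infimum is attained. *)
  pose S c := [set y | exists2 x, I x <= c%:E & cluster (F @ x) y].
  have Sc c : compact (S c) by exact: (compact_cluster_image hY cF (Icpt c)).
  have -> : [set y | J y <= a%:E] =
      \bigcap_(e in [set e : R | (0 < e)%R]) S (a + e)%R.
    apply/seteqP; split => y /=.
      move=> Jy e /= e0.
      have : J y < (a + e)%:E by apply: le_lt_trans Jy _; rewrite lte_fin ltrDl.
      by case/ereal_inf_lt => _ [x xy <-] /ltW; exists x.
    move=> yS; apply/lee_addgt0Pr => e e0.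
    have [x Ix xy] := yS _ e0.
    by apply: ge_ereal_inf; exists (I x) => //; exists x.
  apply: (subclosed_compact _ (Sc (a + 1)%R)); last first.
    by move=> y; apply; rewrite /= ltr01.
  by apply: closed_bigI => e _; exact: compact_closed.
- move=> B bB p; split.
  (* The lower bound for the open set E, whose closure contains every x that
     has a cluster value in the interior of B. *)
  + pose E := (F @^-1` B^°)^°.
    have bE : borel E by apply: borel_open; exact: open_interior.
    have [lb _] := ldp _ bE.
    apply: (@le_trans _ _ (limn_einf (log_prob Z E))); last first.
      apply: le_limn_einf; apply: le_log_prob => // L w /interior_subset.
      exact: interior_subset.
    apply: le_trans lb; rewrite leeN2.
    apply: le_ereal_inf_tmp => _ [y yB <-].
    apply: le_ereal_inf_tmp => _ [x /= xy <-].
    rewrite leNgt; apply/negP => Ix.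
    have xU : nbhs x [set z | I z < ereal_inf [set I x | x in E^°]].
      apply: (cI x [set y | y < _]).
      by apply: open_nbhs_nbhs; split; [exact: open_ereal_lt_ereal|exact: Ix].
    pose A := F @` [set z | I z < ereal_inf (I @` E^°)]^°.
    have xA : (F @ x) A by apply: filterS (nbhs_interior xU) => z Uz; exists z.
    have [_ [[z Uz <-] Bz]] := xy _ _ xA (nbhs_interior yB).
    have [v [/= Iv Bv cv]] := qF _ _ _ Uz (nbhs_interior Bz).
    have Ev : E^° v.
      by rewrite /E (interior_id _).1;
        [exact: (cv _ (nbhs_interior Bv))|exact: open_interior].
    by move: Iv; rewrite ltNge => /negP; apply; apply: ereal_inf_lbound; exists v.
  + pose D := [set x : X | cluster (F @ x) `&` closure B !=set0].
    have cD : closed D.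
      by apply: closed_cluster_meets => //; exact: closed_closure.
    have bD : borel D by exact: borel_closed.
    have [_ ub] := ldp _ bD.
    apply: (@le_trans _ _ (limn_esup (log_prob Z D))).
      apply: le_limn_esup; apply: le_log_prob => // L w FB.
      exists (F (Z L w)); split; last exact: (subset_closure FB).
      move=> A V xA xV; exists (F (Z L w)).
      by split; [exact: (@nbhs_singleton _ _ (F @^-1` A))|exact: nbhs_singleton].
    apply: (le_trans ub); rewrite leeN2 -(closure_id D).1//.
    apply: le_ereal_inf_tmp => _ [x [y [xy yB]] <-].
    apply: ge_ereal_inf; exists (J y); first by exists y.
    by apply: ge_ereal_inf; exists (I x) => //; exists x.
Qed.
End Contraction.

(** * Sets of matrices *)

Section MatrixSets.
Context {R : realType} {m n : nat} (A : set 'M[R]_(m, n)).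
Implicit Types x y : A.

Lemma mx_ballP x y e : 0 < e ->
  ball x e y <-> forall i j, `|val x i j - val y i j| < e.
Proof.
by move=> e0; split => [[_ xy]|xy]; [exact: xy|split => // i j; exact: xy].
Qed.

Lemma mx_cvgP (T : Type) (F : set_system T) (f : T -> A) y : Filter F ->
  f @ F --> y <-> forall i j, val (f t) i j @[t --> F] --> val y i j.
Proof.
move=> FF; split=> [/cvg_ballP fy i j|fy].
  apply/cvg_ballP => e e0; apply: filterS (fy _ e0) => t.
  by move=> /(mx_ballP _ _ e0); apply.
apply/cvg_ballP => e e0.
have ye : \forall t \near F, forall i j, ball (val y i j) e (val (f t) i j).
  apply: filter_forall => i; apply: filter_forall => j.
  by have /cvg_ballP := fy i j; exact.
by apply: filterS ye => t yt; apply/mx_ballP.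
Qed.

Lemma mx_continuousP (T : topologicalType) (f : T -> A) t :
  {for t, continuous f} <->
  forall i j, {for t, continuous (fun z => val (f z) i j)}.
Proof. exact: (mx_cvgP f (f t) (nbhs_filter t)). Qed.

Lemma mx_coord_continuous i j : continuous (fun x : A => val x i j).
Proof. by move=> x; apply: (mx_continuousP id x).1; exact: cvg_id. Qed.

Lemma mx_hausdorff : hausdorff_space A.
Proof.
rewrite ball_hausdorff => x y xy.
have [i [j xyij]] : exists i j, val x i j != val y i j.
  apply: contrapT => xyN; move/eqP: xy; apply; apply/val_inj/matrixP => i j.
  by apply/eqP/negP => /negP ?; apply: xyN; exists i, j.
have d0 : 0 < `|val x i j - val y i j| / 2.
  by rewrite divr_gt0// normr_gt0 subr_eq0.
exists (PosNum d0, PosNum d0) => /=; apply/eqP/seteqP; split => // z [].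
move=> /(mx_ballP _ _ d0)/(_ i j) xz /(mx_ballP _ _ d0)/(_ i j) yz.
have := ler_distD (val z i j) (val x i j) (val y i j).
rewrite (distrC (val z i j)); lra.
Qed.

Let mx_box (c : 'M[rat]_(m, n) * nat) : set A :=
  [set y : A | forall i j, `|val y i j - ratr (c.1 i j)| < c.2.+1%:R^-1].

Let open_mx_boxE (U : set A) : open U ->
  U = \bigcup_(c in [set c | mx_box c `<=` U]) mx_box c.
Proof.
move=> oU; apply/seteqP; split=> [x Ux|x [c /= cU]]; last exact: cU.
have /nbhs_ballP[e /= e0 xeU] : nbhs x U by exact: open_nbhs_nbhs.
have e20 : 0 < e / 2 by rewrite divr_gt0.
have [k ke] := filter_ex (near_infty_natSinv_lt (PosNum e20)).
have k0 : 0 < k.+1%:R^-1 :> R by rewrite invr_gt0.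
have /choice[q xq] (ij : 'I_m * 'I_n) : exists q : rat,
    `|val x ij.1 ij.2 - ratr q| < k.+1%:R^-1.
  have /rat_in_itvoo[q] : val x ij.1 ij.2 - k.+1%:R^-1 <
      val x ij.1 ij.2 + k.+1%:R^-1.
    by rewrite ltrBlDr -addrA ltrDl addr_gt0.
  by rewrite in_itv/= => qx; exists q; rewrite distrC ltr_distl.
exists (\matrix_(i, j) q (i, j), k); last first.
  by move=> i j; rewrite /= mxE; exact: (xq (i, j)).
move=> y yb; apply: xeU; apply/mx_ballP => // i j.
rewrite (le_lt_trans (ler_distD (ratr (q (i, j))) _ _))// (splitr e).
rewrite ltrD ?(lt_trans _ ke)//; first exact: (xq (i, j)).
by have := yb i j; rewrite /= mxE distrC.
Qed.

(** Rational boxes form a countable base, so every open set is a countable union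
    of sets that are described by finitely many coordinates. *)
Lemma mx_random_elementP d (Omega : measurableType d) (Z : Omega -> A) :
  random_element Z <-> forall i j, measurable_fun setT (fun w => val (Z w) i j).
Proof.
split=> [mZ i j|mZ].
  apply: (measurability _ (measurable_realfun.RGenOpens.measurableE R)).
  move=> _ [_ [a [b ->]] <-].
  rewrite setTI; apply: (mZ [set x : A | val x i j \in `]a, b[%R]).
  apply: sub_gen_smallest.
  apply: (@open_comp _ _ (fun x : A => val x i j) `]a, b[%classic); last first.
    exact: itv_open.
  by move=> x _; exact: mx_coord_continuous.
apply: smallest_sub.
  split; first by rewrite preimage_set0.
    by move=> B mB; rewrite setTD preimage_setC; exact: measurableC.
  by move=> B mB; rewrite preimage_bigcup; exact: bigcupT_measurable.
move=> U /open_mx_boxE ->; rewrite preimage_bigcup bigcup_mkcond.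
apply: countable_bigcupT_measurable; first exact: countableP.
move=> c; case: ifP => // _.
have -> : Z @^-1` mx_box c = \bigcap_(ij in [set: 'I_m * 'I_n])
    (fun w => val (Z w) ij.1 ij.2) @^-1`
      ball (ratr (c.1 ij.1 ij.2) : R) c.2.+1%:R^-1.
  apply/seteqP; split=> w /= h => [[i j] _|i j].
    by rewrite /= /ball/= distrC; exact: h.
  by rewrite distrC; exact: (h (i, j)).
apply: fin_bigcap_measurable => // ij _.
by rewrite -[X in measurable X]setTI; apply: mZ => //;
  exact: measurable_realfun.measurable_ball.
Qed.

End MatrixSets.

Lemma compact_orthant_box (R : realType) m n (M : R) :
  compact [set x : orthant R m n | forall i j, val x i j <= M].
Proof.
rewrite compact_ultra => G GU GM.
have /choice[l lP] (ij : 'I_m * 'I_n) : exists l, 0 <= l <= M /\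
    (fun x : orthant R m n => val x ij.1 ij.2) @ G --> l.
  have [|l] := @ultra_compact_cvg R^o _ G
    (fun x : orthant R m n => val x ij.1 ij.2) `[0, M] GU
    (@segment_compact R 0 M).
    apply: filterS GM => x xM; rewrite /= in_itv/=.
    by rewrite xM andbT orthantP.
  by rewrite /= in_itv/=; exists l.
have l0 : orthant R m n (\matrix_(i, j) l (i, j)).
  by move=> i j; rewrite mxE; have [/andP[]] := lP (i, j).
exists (to_orthant l0); split=> [i j|].
  by rewrite /= mxE; have [/andP[]] := lP (i, j).
apply/(mx_cvgP id) => i j; rewrite /= mxE.
by have [_] := lP (i, j).
Qed.

(** * The max-weight rule at interior continuity points *)

Section Inner.
Context {R : realType} {K : nat}.
Implicit Types u v w : 'cV[R]_K.

Lemma innerBl u v w : inner (u - v) w = inner u w - inner v w.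
Proof. by rewrite /inner -sumrB; apply: eq_bigr => k _; rewrite !mxE mulrBl. Qed.

Lemma innerDr u v w : inner u (v + w) = inner u v + inner u w.
Proof.
by rewrite /inner -big_split; apply: eq_bigr => k _; rewrite !mxE mulrDr.
Qed.

Lemma innerZr c u v : inner u (c *: v) = c * inner u v.
Proof.
by rewrite /inner mulr_sumr; apply: eq_bigr => k _; rewrite !mxE mulrCA.
Qed.

End Inner.

Lemma small_multiple (R : realType) (I : finType) (c m : I -> R) :
    (forall i, 0 <= c i) -> (forall i, 0 < m i) ->
  exists2 s, 0 < s & forall i, s * c i < m i.
Proof.
move=> c0 m0.
have c1 i : 0 < c i + 1 by rewrite ltr_wpDl.
have sm : \forall s \near (0 : R)^'+, forall i, s * c i < m i.
  apply: filter_forall => i.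
  near=> s.
  have s0 : 0 < s by near: s; exact: nbhs_right_gt.
  apply: (@le_lt_trans _ _ (s * (c i + 1))); first by rewrite ler_pM2l// lerDl.
  rewrite -ltr_pdivlMr//; near: s; apply: nbhs_right_lt; exact: divr_gt0.
have [s [s0 sP]] := filter_ex (filterI (nbhs_right_gt (0 : R)) sm).
by exists s.
Unshelve. all: by end_near. Qed.

Section Scheduler.
Context {R : realType} {K : nat} {Rg : set 'cV[R]_K}.
Hypothesis Rg_ge0 : Rg `<=` orthant R K 1.
Variable H : orthant R K 1 -> Rg.
Hypothesis H_qcont : quasi_continuous H.
Hypothesis H_argmax : forall w, weight_argmax Rg (val w) (val (H w)).
Implicit Types (u w x : orthant R K 1).

Definition interior_pt (x : orthant R K 1) := forall k, 0 < val x k 0.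

Lemma schedule_ge0 w k : 0 <= val (H w) k 0.
Proof. by have [/Rg_ge0] := H_argmax w; exact. Qed.

Lemma interior_pt_nbhs x : interior_pt x -> nbhs x interior_pt.
Proof.
move=> x0; have [e e0 ex] := @small_multiple R 'I_K (fun=> 1) (fun k => val x k 0)
  (fun=> ler01) x0.
apply/nbhs_ballP; exists e => //= y /(mx_ballP _ _ e0) xy k.
by have := ex k; have := xy k 0; rewrite mulr1 ltr_norml; lra.
Qed.

Lemma shift_subproof x (e : {posnum R}) :
  orthant R K 1 (val x + const_mx e%:num).
Proof. by move=> i j; rewrite !mxE addr_ge0// orthantP. Qed.

Definition shift x e : orthant R K 1 := to_orthant (shift_subproof x e).

Lemma interior_shift x e : interior_pt (shift x e).
Proof. by move=> k; rewrite !mxE ltr_wpDl// orthantP. Qed.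

Lemma interior_pt_dense x (U : set (orthant R K 1)) : nbhs x U ->
  exists2 y, U y & interior_pt y.
Proof.
move=> /nbhs_ballP[e /= e0 xU].
have e20 : 0 < e / 2 by rewrite divr_gt0.
exists (shift x (PosNum e20)); last exact: interior_shift.
apply: xU; apply/mx_ballP => // i j.
by rewrite !mxE opprD addNKr normrN gtr0_norm// ltr_pdivrMr// ltr_pMr// ltr1n.
Qed.

Lemma scale_subproof (c : {posnum R}) x : orthant R K 1 (c%:num *: val x).
Proof. by move=> i j; rewrite !mxE mulr_ge0// orthantP. Qed.

Definition scale c x : orthant R K 1 := to_orthant (scale_subproof c x).

(** If r were another maximizer at u, then moving the weight from u a little in
    the direction D = r - H u would keep the service at least as good as r in that
    direction, so H would jump by at least |D| at u.  Interiority is needed for the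
    moved weight to stay in the orthant. *)
Lemma argmax_unique u : interior_pt u -> {for u, continuous H} ->
  forall r, weight_argmax Rg (val u) r -> r = val (H u).
Proof.
move=> u0 Hu r [Rr rmax].
(* D is made opaque to keep [mxE] from unfolding it. *)
have [D DE] : exists D, D = r - val (H u) by exists (r - val (H u)).
have DD0 : inner D D <= 0.
  apply/ler_addgt0Pr => e e0; rewrite add0r.
  pose C := \sum_k `|D k 0| + 1.
  have C0 : 0 < C by rewrite ltr_wpDl// sumr_ge0.
  have eC0 : 0 < e / C by rewrite divr_gt0.
  have /nbhs_ballP[eta /= eta0 Heta] := Hu _ (nbhsx_ballx (H u) _ eC0).
  have [s s0 sP] := @small_multiple R 'I_K (fun k => `|D k 0|)
    (fun k => Num.min (val u k 0) eta) (fun k => normr_ge0 _)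
    ltac:(by move=> k; rewrite lt_min u0).
  have us0 : orthant R K 1 (val u + s *: D).
    move=> k j; rewrite ord1 !mxE.
    have := sP k; rewrite lt_min => /andP[+ _].
    move=> /ltW sD.
    have := ler_norm (- (s * D k 0)); rewrite normrN normrM gtr0_norm//.
    by lra.
  pose us := to_orthant us0.
  have rs : forall k, `|val (H us) k 0 - val (H u) k 0| < e / C.
    move=> k; have /(mx_ballP _ _ eC0)/(_ k 0) : ball (H u) (e / C) (H us).
      apply: Heta; apply/mx_ballP => // i j; rewrite /= !ord1 !mxE.
      rewrite opprD addNKr normrN normrM gtr0_norm//.
      by have := sP i; rewrite lt_min => /andP[].
    by rewrite distrC.
  have h1 : inner r (val u + s *: D) <= inner (val (H us)) (val u + s *: D).
    by have [_] := H_argmax us; exact.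
  have h2 : inner (val (H us)) (val u) <= inner r (val u).
    by apply: rmax; have [] := H_argmax us.
  have h3 : inner r D <= inner (val (H us)) D.
    rewrite -(ler_pM2l s0) -(lerD2l (inner r (val u))).
    by move: h1; rewrite !innerDr !innerZr => /le_trans; apply; rewrite lerD2r.
  rewrite {1}DE innerBl.
  apply: (@le_trans _ _ (inner (val (H us) - val (H u)) D)).
    by rewrite innerBl lerD2r.
  apply: (@le_trans _ _ (\sum_k e / C * `|D k 0|)).
    apply: ler_sum => k _; rewrite !mxE.
    rewrite (le_trans (ler_norm _))// normrM ler_wpM2r//.
    exact/ltW/rs.
  rewrite -mulr_sumr mulrAC ler_pdivrMr// ler_pM2l// lerDl//.
apply/eqP; rewrite -subr_eq0 -DE; apply/eqP/matrixP => k j; rewrite ord1 [RHS]mxE.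
have DDk i : 0 <= D i 0 * D i 0 by rewrite -expr2 sqr_ge0.
have : inner D D == 0 by rewrite eq_le DD0 sumr_ge0.
rewrite psumr_eq0// => /allP/(_ k); rewrite mem_index_enum => /(_ isT).
by rewrite /= mulf_eq0 orbb => /eqP.
Qed.

Lemma schedule_scale u c : interior_pt u -> {for u, continuous H} ->
  val (H (scale c u)) = val (H u).
Proof.
move=> u0 Hu; apply: argmax_unique => //.
have [RH Hmax] := H_argmax (scale c u); split => // r Rr.
by have := Hmax _ Rr; rewrite /= !innerZr ler_pM2l.
Qed.
End Scheduler.

(** * Moving a workload while keeping its drain small *)

Section Steering.
Context {R : realType} {K : nat} {Rg : set 'cV[R]_K}.
Hypothesis Rg_ge0 : Rg `<=` orthant R K 1.
Variable H : orthant R K 1 -> Rg.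
Hypothesis H_qcont : quasi_continuous H.
Hypothesis H_argmax : forall w, weight_argmax Rg (val w) (val (H w)).
Implicit Types (u w x : orthant R K 1).

(** Quasi-continuity alone may give continuity points on the boundary of the
    orthant; one of them is first replaced by an interior point of a neighbourhood
    on which H varies little. *)
Lemma continuity_pt_nearby w U V : nbhs w U -> nbhs (H w) V ->
  exists u, [/\ interior_pt u, U u, V (H u) & {for u, continuous H}].
Proof.
have qH := (quasi_continuousP H).1 H_qcont => wU wV.
have [v [Uv Vv Hv]] := qH _ _ _ (nbhs_interior wU) (nbhs_interior wV).
have vUV : nbhs v (U° `&` H @^-1` V°).
  by apply: filterI; [exact: nbhs_interior|exact: (Hv _ (nbhs_interior Vv))].
have [p [Up Vp] p0] := interior_pt_dense vUV.
have pU : nbhs p (U `&` interior_pt (K := K)).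
  by apply: filterI => //; exact: interior_pt_nbhs.
have [u [[Uu u0] Vu Hu]] := qH _ _ _ pU (Vp : nbhs (H p) V).
by exists u; split=> //; exact: interior_subset.
Qed.

Definition drain w : 'cV[R]_K :=
  \col_k Num.max 0 (val w k 0 - val (H w) k 0).

(** The margin d must be fixed before the target x is known.  It comes from
    shrinking the workload by the factor [1 - t], which gains [t * w k] in each
    coordinate with [w k > 0] and costs less than e / 2 in distance; the remaining
    errors h may depend on x, and in particular are smaller than its coordinates,
    which settles the coordinates with [w k = 0]. *)
Lemma drain_below w e : 0 < e -> exists2 d, 0 < d &
  forall x, interior_pt x -> (forall k, drain w k 0 - d <= val x k 0) ->
  exists w', [/\ interior_pt w', ball w e w', ball (H w) e (H w'),
    {for w', continuous H} & forall k, drain w' k 0 <= val x k 0].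
Proof.
move=> e0; have w0 k : 0 <= val w k 0 by exact: orthantP.
have [s s0 sw] := @small_multiple R 'I_K (fun k => val w k 0) (fun=> e / 2)
  w0 (fun=> divr_gt0 e0 (ltr0Sn _ _)).
pose t := Num.min s (1 / 2).
have t0 : 0 < t by rewrite lt_min s0 divr_gt0.
have tw k : t * val w k 0 < e / 2.
  by apply: le_lt_trans (sw k); rewrite ler_wpM2r// ge_min lexx.
have c0 : 0 < 1 - t by rewrite subr_gt0 gt_min; apply/orP; right; lra.
pose c := PosNum c0.
have [d d0 dw] := @small_multiple R 'I_K (fun=> 2)
  (fun k => if 0 < val w k 0 then t * val w k 0 else 1) (fun=> ler0n _ 2)
  ltac:(by move=> k /=; case: ifPn => // wk; rewrite mulr_gt0).
exists d => // x x0 dx.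
(* The steps from w to u and from [(1 - t) u] to w' each cost an error h in the
   workload and another one in the schedule, hence the factor 4. *)
have [h h0 hx] := @small_multiple R 'I_K (fun=> 4)
  (fun k => Num.min (val x k 0) (Num.min e d)) (fun=> ler0n _ 4)
  ltac:(by move=> k; rewrite !lt_min x0 e0).
have [u [u0 wu Hwu Hu]] :=
  continuity_pt_nearby (nbhsx_ballx w _ h0) (nbhsx_ballx (H w) _ h0).
have [w' [w'0 uw' Huw' Hw']] := continuity_pt_nearby
  (nbhsx_ballx (scale c u) _ h0) (nbhsx_ballx (H (scale c u)) _ h0).
have bounds k : [/\ `|(1 - t) * (val w k 0 - val u k 0)| < h,
    `|val (H w) k 0 - val (H u) k 0| < h,
    `|(1 - t) * val u k 0 - val w' k 0| < h &
    `|val (H u) k 0 - val (H w') k 0| < h].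
  have wuk : `|val w k 0 - val u k 0| < h by move/(mx_ballP _ _ h0) : wu; exact.
  have -> : `|(1 - t) * (val w k 0 - val u k 0)| < h.
    apply: le_lt_trans wuk; rewrite normrM (gtr0_norm c0) ler_piMl//.
    by rewrite lerBlDr lerDl ltW.
  move/(mx_ballP _ _ h0) : Hwu => /(_ k 0) ->.
  move/(mx_ballP _ _ h0) : uw' => /(_ k 0); rewrite /= mxE => ->.
  by move/(mx_ballP _ _ h0) : Huw' => /(_ k 0); rewrite schedule_scale// => ->.
exists w'; split=> //.
- apply/mx_ballP => // k j; rewrite ord1.
  have [wuk _ uwk _] := bounds k.
  have := hx k; rewrite !lt_min => /and3P[_ he _].
  have := tw k; have twk : 0 <= t * val w k 0 by rewrite mulr_ge0// ltW.
  move: wuk uwk; rewrite !ltr_norml => /andP[? ?] /andP[? ?] ?.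
  apply/andP; split; lra.
- apply/mx_ballP => // k j; rewrite ord1.
  have [_ wuk _ uwk] := bounds k.
  have := hx k; rewrite !lt_min => /and3P[_ he _].
  apply: le_lt_trans (ler_distD (val (H u) k 0) _ _) _; lra.
- move=> k; rewrite mxE ge_max ltW//=.
  have := hx k; rewrite !lt_min => /and3P[hxk _ hd].
  have [wuk Hwuk uwk Huwk] := bounds k.
  move: wuk Hwuk uwk Huwk.
  rewrite !ltr_norml => /andP[? ?] /andP[? ?] /andP[? ?] /andP[? ?].
  have [wk|wk] := ltP 0 (val w k 0).
    have := dx k; have := dw k; rewrite wk mxE => ? xk.
    have : val w k 0 - val (H w) k 0 - d <= val x k 0.
      by apply: le_trans xk; rewrite lerD2r le_max lexx orbT.
    lra.
  have wk0 : val w k 0 = 0 by apply/eqP; rewrite eq_le wk w0.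
  have := schedule_ge0 Rg_ge0 H_argmax w' k.
  have : t * val w k 0 = 0 by rewrite wk0 mulr0.
  lra.
Qed.

End Steering.

(** * The workload over a finite horizon *)

Section Horizon.
Context {R : realType} {K : nat}.

Lemma older_subproof T (a : orthant R K T.+1) :
  orthant R K T (col' ord0 (val a)).
Proof. by move=> k s; rewrite mxE orthantP. Qed.

Definition older T (a : orthant R K T.+1) : orthant R K T :=
  to_orthant (older_subproof a).

Lemma prepend_subproof T (c : 'cV[R]_K) (a : orthant R K T) :
  orthant R K 1 c -> orthant R K T.+1 (row_mx c (val a)).
Proof.
by move=> c0 k s; rewrite mxE; case: fintype.split => j; rewrite ?orthantP.
Qed.

Definition prepend T (c : 'cV[R]_K) (c0 : orthant R K 1 c) (a : orthant R K T) :
    orthant R K T.+1 :=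
  to_orthant (prepend_subproof a c0).

Lemma prepend0 T c c0 (a : orthant R K T) k :
  val (@prepend T c c0 a) k ord0 = c k 0.
Proof. by rewrite /= mxE; case: splitP => [j _|j //]; rewrite ord1. Qed.

Lemma prependS T c c0 (a : orthant R K T) k s :
  val (@prepend T c c0 a) k (lift ord0 s) = val a k s.
Proof.
rewrite /= mxE; case: splitP => [j|j]; first by rewrite ord1.
by rewrite /= /bump leq0n => -[sj]; congr (val a k _); exact/val_inj.
Qed.

Lemma olderK T c c0 (a : orthant R K T) : older (@prepend T c c0 a) = a.
Proof. by apply/val_inj/matrixP => k s; rewrite mxE; exact: prependS. Qed.

Lemma continuous_older T : continuous (@older T).
Proof.
move=> a; apply/mx_continuousP => k s.
have -> : (fun z => val (older z) k s) =
    (fun z : orthant R K T.+1 => val z k (lift ord0 s)).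
  by apply/funext => z; rewrite /= mxE.
exact: mx_coord_continuous.
Qed.

Context {Rg : set 'cV[R]_K}.
Hypothesis Rg_ge0 : Rg `<=` orthant R K 1.
Variable H : orthant R K 1 -> Rg.
Hypothesis H_qcont : quasi_continuous H.
Hypothesis H_argmax : forall w, weight_argmax Rg (val w) (val (H w)).

(** The newest slot has index [ord0], so the recursion in the horizon peels off
    the first column. *)
Lemma workloadS T (a : orthant R K T.+1) :
  val (workload H a) = drain H (workload H (older a)) + col ord0 (val a).
Proof.
rewrite /workload enum_ordSl/= foldr_map.
have -> w : foldr (fun s => step H a (lift ord0 s)) w (enum 'I_T) =
    foldr (step H (older a)) w (enum 'I_T).
  elim: (enum _) => //= s l ->; apply/val_inj/matrixP => k j.
  by rewrite /= !mxE.
by apply/matrixP => k j; rewrite !mxE.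
Qed.

Lemma workload1 (a : orthant R K 1) : workload H a = a.
Proof.
apply/val_inj; rewrite workloadS; apply/matrixP => k j; rewrite !ord1 !mxE.
rewrite /workload enum_ord0/= mxE sub0r.
by rewrite max_l ?add0r// oppr_le0 (schedule_ge0 Rg_ge0 H_argmax).
Qed.

Lemma drain_lipschitz u w k :
  `|drain H u k 0 - drain H w k 0| <=
  `|val u k 0 - val w k 0| + `|val (H u) k 0 - val (H w) k 0|.
Proof.
have max_lipschitz (p q : R) : `|Num.max 0 p - Num.max 0 q| <= `|p - q|.
  by case: (leP 0 p) => p0; case: (leP 0 q) => q0; rewrite ler_norml;
    apply/andP; split; case: (leP 0 (p - q)) => pq;
    rewrite ?(ger0_norm pq) ?(ltr0_norm pq); lra.
rewrite !mxE; apply: le_trans (max_lipschitz _ _) _.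
apply: le_trans (ler_normB _ _); rewrite le_eqVlt; apply/orP; left; apply/eqP.
by congr `|_|; ring.
Qed.

Lemma continuous_workloadS T (a : orthant R K T.+1) :
  {for older a, continuous (@workload _ _ _ H T)} ->
  {for workload H (older a), continuous H} ->
  {for a, continuous (@workload _ _ _ H T.+1)}.
Proof.
move=> ca cH; apply/mx_continuousP => k j; rewrite ord1.
have cW : {for a, continuous (fun z => workload H (older z))}.
  by apply: continuous_comp ca; exact: continuous_older.
have cHW : {for a, continuous (fun z => H (workload H (older z)))}.
  exact: (continuous_comp cW).
pose W (z : orthant R K T.+1) := workload H (older z).
have -> : (fun z => val (workload H z) k 0) = (fun z : orthant R K T.+1 =>
    Num.max 0 (val (W z) k 0 - val (H (W z)) k 0) + val z k ord0).
  by apply/funext => z; rewrite workloadS !mxE.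
have /mx_continuousP/(_ k 0) cWk := cW.
have /mx_continuousP/(_ k 0) cHWk := cHW.
have cmax : continuous (fun p : R => Num.max 0 p).
  move=> p; apply: (@continuous_max R R (cst 0) id p); last exact: cvg_id.
  exact: cst_continuous.
have cg : {for a, continuous (fun z => val (W z) k 0 - val (H (W z)) k 0)}.
  exact: (cvgB cWk cHWk).
have cm := continuous_comp cg (cmax _).
exact: (cvgD cm (@mx_coord_continuous _ _ _ _ k ord0 a)).
Qed.

(** Prescribing the final workload x exactly, and not just approximately, is what
    lets the induction run: the point found for the older arrivals by
    [drain_below] becomes their prescribed workload, and the newest arrival is
    whatever is missing to reach x.  The base case is horizon 1, where the workload
    is the arrival itself; at horizon 0 the workload cannot be moved. *)
Lemma workload_steering T (a : orthant R K T.+1) e : 0 < e ->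
  exists2 d, 0 < d & forall x, interior_pt x -> ball (workload H a) d x ->
    exists a', [/\ ball a e a', workload H a' = x &
                   {for a', continuous (@workload _ _ _ H T.+1)}].
Proof.
elim: T a e => [|T IH] a e e0.
  exists e => // x x0 ax; exists x; rewrite !workload1 in ax *; split => //.
  by have -> : @workload _ _ _ H 1 = id by apply/funext => z; rewrite workload1.
have [d1 d10 steer] := IH (older a) e e0.
set W := workload H (older a) in steer.
have e10 : 0 < Num.min (e / 4) d1 by rewrite lt_min d10 divr_gt0.
have [d2 d20 below] := drain_below Rg_ge0 H_qcont H_argmax W e10.
have d0 : 0 < Num.min (e / 4) d2 by rewrite lt_min d20 divr_gt0.
exists (Num.min (e / 4) d2) => // x x0 /(mx_ballP _ _ d0) ax.
have {}ax k : `|drain H W k 0 + val a k ord0 - val x k 0| < Num.min (e / 4) d2.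
  by have := ax k 0; rewrite workloadS mxE [X in _ + X - _]mxE.
have [|w [w0 /(mx_ballP _ _ e10) Ww /(mx_ballP _ _ e10) HWw Hw wx]] := below x x0.
  move=> k; have := ax k; have a0 := orthantP a k ord0.
  by rewrite lt_min !ltr_norml => /andP[_ /andP[? ?]]; lra.
have [|b [ab bw cb]] := steer w w0.
  apply/mx_ballP => // k j; apply: lt_le_trans (Ww k j) _.
  by rewrite ge_min lexx orbT.
have c0 : orthant R K 1 (val x - drain H w).
  by move=> k j; rewrite !ord1 mxE [X in _ + X]mxE subr_ge0.
exists (prepend c0 b); split.
- move/(mx_ballP _ _ e0) : ab => ab; apply/mx_ballP => // k s.
  have [s' ->|->] := unliftP ord0 s.
    by rewrite prependS; have := ab k s'; rewrite /= mxE.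
  rewrite prepend0 [X in _ - X]mxE [X in _ - (_ + X)]mxE; have := ax k.
  have := drain_lipschitz w W k; have := Ww k 0; have := HWw k 0.
  rewrite !lt_min => /andP[HWwk _] /andP[Wwk _] dk /andP[axk _].
  have {}dk : `|drain H W k 0 - drain H w k 0| < e / 4 + e / 4.
    by rewrite distrC; apply: le_lt_trans dk _; rewrite ltrD// distrC.
  move: dk axk; rewrite !ltr_norml => /andP[? ?] /andP[? ?].
  by apply/andP; split; lra.
- apply/val_inj; rewrite workloadS olderK bw; apply/matrixP => k j.
  rewrite ord1 mxE [X in _ + X]mxE prepend0 [X in _ + X]mxE [X in _ + (_ + X)]mxE.
  by rewrite addrC subrK.
- by apply: continuous_workloadS; rewrite olderK ?bw.
Qed.

Lemma quasi_continuous_workload T : (0 < T)%N ->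
  quasi_continuous (@workload _ _ _ H T).
Proof.
case: T => // T _; apply/quasi_continuousP => a U V.
move=> /nbhs_ballP[e /= e0 aU] aV.
have [d d0 steer] := workload_steering a e0.
have [x [dx Vx] x0] := interior_pt_dense
  (filterI (nbhsx_ballx (workload H a) _ d0) aV).
have [a' [aa' a'x ca']] := steer x x0 dx.
by exists a'; split; [exact: aU|rewrite a'x|].
Qed.

Lemma workload_le T (a : orthant R K T) k :
  val (workload H a) k 0 <= \sum_s val a k s.
Proof.
elim: T a => [|T IH] a; first by rewrite /workload enum_ord0/= mxE big_ord0.
rewrite workloadS mxE big_ord_recl addrC lerD ?mxE//.
have -> : \sum_s val a k (lift ord0 s) = \sum_s val (older a) k s.
  by apply: eq_bigr => s _; rewrite /= mxE.
rewrite ge_max sumr_ge0 => [/=|s _]; last exact: orthantP.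
apply: le_trans (IH (older a)); rewrite gerBl.
exact: (schedule_ge0 Rg_ge0 H_argmax).
Qed.

Lemma locally_relatively_compact_workload T :
  locally_relatively_compact (@workload _ _ _ H T).
Proof.
move=> a; pose M := \sum_k \sum_s (val a k s + 1).
exists [set x : orthant R K 1 | forall i j, val x i j <= M].
  exact: compact_orthant_box.
apply: filterS (nbhsx_ballx a 1 ltr01) => z /(mx_ballP _ _ ltr01) az k j.
rewrite ord1; apply: le_trans (workload_le z k) _.
rewrite /M (bigD1 k)//=; apply: ler_wpDr; last first.
  by apply: ler_sum => s _; have := az k s; rewrite ltr_norml => /andP[]; lra.
by apply: sumr_ge0 => i _; apply: sumr_ge0 => s _; rewrite addr_ge0 ?orthantP.
Qed.

Lemma random_workload d (Omega : measurableType d) T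
    (Z : Omega -> orthant R K T) :
  borel_fun H -> random_element Z -> random_element (@workload _ _ _ H T \o Z).
Proof.
move=> bH; elim: T Z => [|T IH] Z /mx_random_elementP mZ.
  apply/mx_random_elementP => k j; rewrite /workload enum_ord0/=.
  exact: measurable_cst.
have mW : random_element (fun w => workload H (older (Z w))).
  apply: IH; apply/mx_random_elementP => k s.
  by under eq_fun do rewrite /= mxE; exact: mZ.
have mHW : random_element (fun w => H (workload H (older (Z w)))).
  by move=> B bB; exact: (mW _ (bH _ bB)).
apply/mx_random_elementP => k j; rewrite ord1.
under eq_fun do rewrite /= workloadS mxE [X in X + _]mxE [X in _ + X]mxE.
apply: measurable_realfun.measurable_funD; last exact: mZ.
apply: measurable_realfun.measurable_maxr; first exact: measurable_cst.
by apply: measurable_realfun.measurable_funB; exact: (mx_random_elementP _).1.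
Qed.
End Horizon.

(** * The large deviation principle for workloads *)

Theorem theorem1 (R : realType) (K : nat) (K_gt0 : (0 < K)%N)
    (Rg : set 'cV[R]_K)
    (Rg_ge0 : Rg `<=` orthant R K 1)
    (Rg_compact : compact Rg)
    (Rg_convex : convex_set Rg)
    (Rg_cconvex : coordinate_convex Rg)
    (H : orthant R K 1 -> Rg)
    (H_borel : borel_fun H)
    (H_qcont : quasi_continuous H)
    (H_argmax : forall w : orthant R K 1, weight_argmax Rg (val w) (val (H w)))
    (mu : orthant R K 1)
    (d : nat -> measure_display)
    (Omega : forall L, measurableType (d L))
    (P : forall L, probability (Omega L) R)
    (A : forall L, Omega L -> path_spaceK mu)
    (A_stationary : forall L k, stationary (P L) (fun w => val (A L w k)))
    (A_indep : forall L,
      mutually_independent (P L) (fun k w => val (A L w k)))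
    (A_mean : forall L k s,
      ('E_(P L)[fun w => path_val (val (A L w k)) s] = (val mu k 0)%:E)%E)
    (Isharp : path_spaceK mu -> \bar R)
    (Isharp_ : forall t, orthant R K t -> \bar R)
    (A_sample_path_LDP : LDP P A Isharp)
    (A_finite_LDP : forall t, (0 < t)%N ->
      LDP P (fun L w => restrict_path t (A L w)) (Isharp_ t))
    (Isharp_sup : forall a : path_spaceK mu,
      Isharp a = ereal_sup [set Isharp_ t (restrict_path t a) | t in [set t | (0 < t)%N]])
    (Isharp_lim : forall a : path_spaceK mu,
      Isharp_ t (restrict_path t a) @[t --> \oo] --> Isharp a)
    (Isharp_continuous : forall t, (0 < t)%N -> continuous (Isharp_ t)) :
  forall t, (0 < t)%N ->
    LDP P (fun L w => workload H (restrict_path t (A L w)))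
      (fun b => ereal_inf
        [set Isharp_ t x | x in [set x : orthant R K t |
                                cluster_set (@workload R K Rg H t) x b]]).
Proof.
move=> t t0; have ldp := A_finite_LDP t t0.
apply: (@LDP_quasi_continuous R d Omega P (orthant R K t) (orthant R K 1) _ _
  (@workload R K Rg H t) _ (Isharp_continuous t t0) ldp).
- exact: mx_hausdorff.
- exact: (quasi_continuous_workload Rg_ge0 H_qcont H_argmax t0).
- exact: (locally_relatively_compact_workload Rg_ge0 H_argmax).
- by move=> L; apply: random_workload => //; have [] := ldp.
Qed.
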